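(* Let $(M,g,\mathrm d\alpha)$ be an exact magnetic system of strong geodesic type. Then for every energy value $\kappa\in(0,\infty)$ the magnetic geodesic flow $\Phi^t_{g,\mathrm d\alpha}$ admits a null-homologous embedded periodic orbit of energy $\kappa$, which has non-positive action whenever $\kappa\in(0,c_0(M,g,\mathrm d\alpha)]$. Moreover, the strict Mañé critical value is $$c_0(M,g,\mathrm d\alpha)=\tfrac12\|\alpha\|_\infty^2 .$$ If in addition there exists a magnetic geodesic of strong geodesic type $\gamma$ of $(M,g,\mathrm d\alpha)$ that is contractible, then $$c_u(M,g,\mathrm d\alpha)=c_0(M,g,\mathrm d\alpha)=\tfrac12\|\alpha\|_\infty^2 .$$
   Context: An exact magnetic system $(M,g,\mathrm d\alpha)$ consists of a closed connected Riemannian manifold $(M,g)$ and a one-form $\alpha$ on $M$ (the primitive $\alpha$ is part of the data). The Lorentz force $Y:TM\to TM$ is defined by $g_q(Y_qu,v)=\mathrm d\alpha_q(u,v)$. A magnetic geodesic is a smooth curve $\gamma$ in $M$ with $\nabla_{\dot\gamma}\dot\gamma=Y_\gamma\dot\gamma$; the magnetic geodesic flow $\Phi^t_{g,\mathrm d\alpha}$ on $TM$ sends $(q,v)$ to $(\gamma_{q,v}(t),\dot\gamma_{q,v}(t))$, with $\gamma_{q,v}$ the magnetic geodesic with initial condition $(q,v)$. The energy of a magnetic geodesic is the constant $\frac12 g(\dot\gamma,\dot\gamma)$. Periodic orbits of the flow correspond to periodic magnetic geodesics, and the adjectives embedded, null-homologous (zero class in $H_1(M)$), contractible refer to the projected loop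 in $M$. A smooth embedded loop is a smooth embedding $\gamma:\mathbb R/T\mathbb Z\to M$, $T>0$. It is coorientable if $\gamma^*TM$ is orientable. A magnetic geodesic of geodesic type of $(M,g,\mathrm d\alpha)$ is a smooth embedded loop $\gamma$ that is a geodesic of $(M,g)$ with $\dot\gamma(t)\in\ker \mathrm d\alpha_{\gamma(t)}$ (i.e. $\mathrm d\alpha_{\gamma(t)}(\dot\gamma(t),\cdot)=0$) for all $t$. A magnetic geodesic of strong geodesic type is a coorientable, null-homologous magnetic geodesic $\gamma$ of geodesic type such that (1) $|\alpha_{\gamma(t)}|_g=\max_{x\in M}|\alpha_x|_g=:\|\alpha\|_\infty$ for all $t$, and (2) $g_{\gamma(t)}(\dot\gamma(t),v)=\alpha_{\gamma(t)}(v)$ for all $t$ and all $v\in T_{\gamma(t)}M$. The system is of strong geodesic type if it admits such a $\gamma$. Let $L(q,v)=\frac12|v|_g^2-\alpha_q(v)$ on $TM$ and $S_{L+\kappa}(\gamma)=\int_0^T\big(L(\gamma,\dot\gamma)+\kappa\big)\,\mathrm dt$ for $\gamma\in C^\infty(\mathbb R/T\mathbb Z,M)$. The action of a periodic magnetic geodesic of energy $\kappa$ and period $T$ is $S_{L+\kappa}(\gamma)$. The Mañé critical values are $c_0(M,g,\mathrm d\alpha)=\inf\{\kappa\in\mathbb R: S_{L+\kappa}(\gamma)\ge0\ \forall T>0,\ \forall\gamma\in C^\infty(\mathbb R/T\mathbb Z,M)\text{ homologous to zero}\}$ (strict) and $c_u(M,g,\mathrm d\alpha)=\inf\{\kappa\in\mathbb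 R: S_{L+\kappa}(\gamma)\ge0\ \forall T>0,\ \forall\gamma\in C^\infty(\mathbb R/T\mathbb Z,M)\text{ contractible}\}$ (lowest). *)

(* Defs.v *)
From HB Require Import structures.
From mathcomp Require Import all_boot all_order all_algebra.
From mathcomp Require Import all_classical all_reals all_analysis.

Set Implicit Arguments.
Unset Strict Implicit.
Unset Printing Implicit Defensive.

Import Order.TTheory GRing.Theory Num.Theory.
Import numFieldNormedType.Exports.

Local Open Scope classical_set_scope.
Local Open Scope ring_scope.

Section Smooth.
Context {R : realType} {V W : normedModType R}.

(* U is meant to be open. *)
Fixpoint Ck (k : nat) (U : set V) (f : V -> W) : Prop :=
  (forall x, U x -> {for x, continuous f}) /\
  (if k is k'.+1 then
     forall v, (forall x, U x -> derivable f x v) /\ Ck k' U ('D_v f)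
   else True).

Definition smooth_on (U : set V) (f : V -> W) := forall k, Ck k U f.

End Smooth.

Definition std_simplex (R : realType) (k : nat) : set 'rV[R]_k.+1 :=
  [set x | (forall i, 0 <= x 0 i) /\ \sum_i x 0 i = 1].
Arguments std_simplex {R} k _.

Definition face_map (R : realType) (k : nat) (i : 'I_k.+2) (x : 'rV[R]_k.+1) :
    'rV[R]_k.+2 :=
  \row_j (if unlift i j is Some j' then x 0 j' else 0).

Record chart (R : realType) (n : nat) (M : topologicalType) := Chart {
  dom : set M;
  coord : M -> 'rV[R]_n;
  param : 'rV[R]_n -> M;  (* inverse of coord on coord @` dom *)
  open_dom : open dom;
  open_coord : open (coord @` dom);
  coordK : forall q, dom q -> param (coord q) = q;
  coord_continuous : forall q, dom q -> {for q, continuous coord};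
  param_continuous : forall x, (coord @` dom) x -> {for x, continuous param}
}.

(* Smooth structure given by an atlas; [chart_at] singles out one chart around
   each point and only serves to fix the model of the tangent spaces below. *)
Record manifold (R : realType) (n : nat) := Manifold {
  mspace :> topologicalType;
  mspace_hausdorff : hausdorff_space mspace;
  mspace_second_countable : @second_countable mspace;
  chart_index : Type;
  atlas : chart_index -> chart R n mspace;
  chart_at : mspace -> chart_index;
  mem_chart_at : forall q, dom (atlas (chart_at q)) q;
  atlas_smooth : forall i j,
    smooth_on (coord (atlas i) @` (dom (atlas i) `&` dom (atlas j)))
              (coord (atlas j) \o param (atlas i))
}.

(* T_qM is modelled on R^n: a tangent vector at q is given by its components in
   the chart [chart_at q]. Accordingly a point of TM is a pair (q, v). *)
Definition tangent_bundle (R : realType) (n : nat) (M : manifold R n) : Type :=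
  (M * 'rV[R]_n)%type.

Section Manifold.
Context {R : realType} {n : nat} (M : manifold R n).

Definition closed_connected := compact [set: M] /\ connected [set: M].

(* The tangent vector at q whose components in the chart i are v. *)
Definition tvec (i : chart_index M) (q : M) (v : 'rV[R]_n) : 'rV[R]_n :=
  'D_v (coord (atlas (chart_at q)) \o param (atlas i)) (coord (atlas i) q).

Definition codom_chart (i : chart_index M) : set 'rV[R]_n :=
  coord (atlas i) @` dom (atlas i).

(* Components of fields of bilinear and linear forms in the chart i. *)
Definition bilin_in (g : M -> 'rV[R]_n -> 'rV[R]_n -> R) (i : chart_index M)
    (u v x : 'rV[R]_n) : R :=
  g (param (atlas i) x) (tvec i (param (atlas i) x) u)
                        (tvec i (param (atlas i) x) v).

Definition lin_in (a : M -> 'rV[R]_n -> R) (i : chart_index M)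
    (v x : 'rV[R]_n) : R :=
  a (param (atlas i) x) (tvec i (param (atlas i) x) v).

Record metric := Metric {
  gmet :> M -> 'rV[R]_n -> 'rV[R]_n -> R;
  gmet_linear : forall q a u v w,
    gmet q (a *: u + v) w = a * gmet q u w + gmet q v w;
  gmet_sym : forall q u v, gmet q u v = gmet q v u;
  gmet_pos : forall q v, v != 0 -> 0 < gmet q v v;
  gmet_smooth : forall i u v, smooth_on (codom_chart i) (bilin_in gmet i u v)
}.

Record one_form := OneForm {
  form :> M -> 'rV[R]_n -> R;
  form_linear : forall q a u v, form q (a *: u + v) = a * form q u + form q v;
  form_smooth : forall i v, smooth_on (codom_chart i) (lin_in form i v)
}.

(* da(u, v) = D_u (a v) - D_v (a u) in a chart, u and v being extended with
   constant components. *)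
Definition ext_d (a : one_form) (q : M) (u v : 'rV[R]_n) : R :=
  'D_u (lin_in a (chart_at q) v) (coord (atlas (chart_at q)) q) -
  'D_v (lin_in a (chart_at q) u) (coord (atlas (chart_at q)) q).

(* The vector w such that g_q(w, v) = l v for all v. *)
Definition sharp (g : metric) (q : M) (l : 'rV[R]_n -> R) : 'rV[R]_n :=
  xget 0 [set w | forall v, g q w v = l v].

Lemma sharpP (g : metric) (q : M) (l : 'rV[R]_n -> R) :
  (forall a u v, l (a *: u + v) = a * l u + l v) ->
  forall v, g q (sharp g q l) v = l v.
Proof.
move=> llin.
have expand (h : 'rV[R]_n -> R) : (forall a u v, h (a *: u + v) = a * h u + h v) ->
    forall v, h v = \sum_j v 0 j * h (delta_mx 0 j).
  move=> hlin v.
  have h0 : h 0 = 0.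
    by have := hlin (-1) 0 0; rewrite scaler0 addr0 mulN1r addNr.
  rewrite {1}(row_sum_delta v).
  elim/big_rec2: _ => // j y w _ <-; exact: hlin.
have glinr w a u v : g q w (a *: u + v) = a * g q w u + g q w v.
  by rewrite gmet_sym gmet_linear !(gmet_sym g q w).
pose G := \matrix_(k, j) g q (delta_mx 0 k) (delta_mx 0 j) : 'M[R]_n.
have GE w j : (w *m G) 0 j = g q w (delta_mx 0 j).
  rewrite (expand (fun w => g q w (delta_mx 0 j)) _ w); last first.
    by move=> *; exact: gmet_linear.
  by rewrite mxE; apply: eq_bigr => k _; rewrite mxE.
have Gu : G \in unitmx.
  rewrite -row_free_unit; apply: inj_row_free => w wG.
  apply/eqP; apply: contraT => /(gmet_pos g q).
  rewrite (expand _ (glinr w)) big1 ?ltxx// => j _.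
  by rewrite -GE wG mxE mulr0.
apply: (@xgetI _ 0 [set w | forall v, g q w v = l v]
  ((\row_j l (delta_mx 0 j)) *m invmx G)) => /= v.
rewrite (expand _ (glinr _)) (expand l llin).
by apply: eq_bigr => j _; rewrite -GE mulmxKV// mxE.
Qed.

Definition lorentz_force (g : metric) (a : one_form) (q : M) (u : 'rV[R]_n) :
  'rV[R]_n := sharp g q (ext_d a q u).

(* Levi-Civita connection: covariant derivative at q of the constant-component
   field w along u, from the Koszul formula, i.e. the vector with components
   Gamma^k_{ij} u^i w^j. *)
Definition christoffel (g : metric) (q : M) (u w : 'rV[R]_n) : 'rV[R]_n :=
  let c := chart_at q in
  let x := coord (atlas c) q in
  sharp g q (fun v => 2^-1 * ('D_u (bilin_in g c w v) x +
                              'D_w (bilin_in g c u v) x -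
                              'D_v (bilin_in g c u w) x)).

Definition smooth_curve (c : R -> M) :=
  continuous c /\
  forall i, smooth_on (c @^-1` dom (atlas i)) (coord (atlas i) \o c).

Definition velocity (c : R -> M) (t : R) : 'rV[R]_n :=
  derive1 (coord (atlas (chart_at (c t))) \o c) t.

Definition cov_accel (g : metric) (c : R -> M) (t : R) : 'rV[R]_n :=
  derive1n 2 (coord (atlas (chart_at (c t))) \o c) t +
  christoffel g (c t) (velocity c t) (velocity c t).

Definition geodesic (g : metric) (c : R -> M) :=
  smooth_curve c /\ forall t, cov_accel g c t = 0.

Definition magnetic_geodesic (g : metric) (a : one_form) (c : R -> M) :=
  smooth_curve c /\
  forall t, cov_accel g c t = lorentz_force g a (c t) (velocity c t).

Definition lift_curve (c : R -> M) (t : R) : tangent_bundle M :=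
  (c t, velocity c t).

(* The curves t |-> Phi^t(q, v) in TM. *)
Definition flow_orbit (g : metric) (a : one_form) (z : R -> tangent_bundle M) :=
  exists2 c, magnetic_geodesic g a c & z = lift_curve c.

Definition periodic_flow_orbit (g : metric) (a : one_form) (T : R)
    (z : R -> tangent_bundle M) :=
  [/\ 0 < T, flow_orbit g a z & forall t, z (t + T) = z t].

Definition energy (g : metric) (z : tangent_bundle M) : R :=
  2^-1 * g z.1 z.2 z.2.

(* Loops R/TZ -> M are T-periodic curves. *)
Definition smooth_loop (T : R) (c : R -> M) :=
  [/\ 0 < T, smooth_curve c & forall t, c (t + T) = c t].

(* Smooth embedding of R/TZ: injective immersion inducing the topology of R/TZ,
   whose open sets are the T-periodic open subsets of R. *)
Definition embedded_loop (T : R) (c : R -> M) :=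
  [/\ smooth_loop T c,
      forall t, velocity c t != 0,
      forall s t, c s = c t -> exists k : int, s - t = k%:~R * T &
      forall U : set R, open U -> (forall t, U (t + T) <-> U t) ->
        exists2 O : set M, open O & U = c @^-1` O].

(* c^*TM is orientable: an orientation of T_{c(t)}M is a sign o t, telling
   whether the standard basis of R^n is positive, and it has to be locally
   constant when compared with the coordinate frames of the charts. *)
Definition coordinate_frame (i : chart_index M) (q : M) : 'M[R]_n :=
  \matrix_k tvec i q (delta_mx 0 k).

Definition coorientable (T : R) (c : R -> M) :=
  exists o : R -> R,
    [/\ forall t, o t = 1 \/ o t = -1,
        forall t, o (t + T) = o t &
        forall i t, dom (atlas i) (c t) ->
          \forall s \near t,
            Num.sg (o s * \det (coordinate_frame i (c s))) =
            Num.sg (o t * \det (coordinate_frame i (c t)))].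

(* Singular k-simplices are maps 'rV_k.+1 -> M continuous on the standard
   simplex, identified when they agree there. *)
Definition same_simplex (k : nat) (f h : 'rV[R]_k.+1 -> M) : bool :=
  `[< forall x, std_simplex k x -> f x = h x >].

Definition loop_simplex (T : R) (c : R -> M) (x : 'rV[R]_2) : M :=
  c (x 0 1 * T).

(* The loop vanishes in H_1(M; Z): the singular 1-cycle it defines is the
   boundary of the singular 2-chain sum_k m_k s_k. The equality of chains is
   expressed coefficientwise. *)
Definition null_homologous (T : R) (c : R -> M) :=
  exists (N : nat) (m : 'I_N -> int) (s : 'I_N -> 'rV[R]_3 -> M),
    (forall k, {within std_simplex 2, continuous (s k)}) /\
    forall f : 'rV[R]_2 -> M,
      \sum_(k < N) \sum_(i < 3)
         m k * (-1) ^+ i * (same_simplex (s k \o face_map i) f)%:R =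
      (same_simplex (loop_simplex T c) f)%:R :> int.

(* Free homotopy of loops to a constant loop. *)
Definition contractible (T : R) (c : R -> M) :=
  exists (p : M) (H : R * R -> M),
    [/\ {within `[0, 1] `*` [set: R], continuous H},
        forall s t, s \in `[0, 1] -> H (s, t + T) = H (s, t),
        forall t, H (0, t) = c t &
        forall t, H (1, t) = p].

Definition conorm (g : metric) (a : one_form) (q : M) : R :=
  sup [set `|a q v| | v in [set v | g q v v <= 1]].

(* A maximum by compactness of M; conorm and sup_conorm are sups of bounded
   nonempty sets. *)
Definition sup_conorm (g : metric) (a : one_form) : R :=
  sup (range (conorm g a)).

Definition is_max (A : set R) (m : R) := A m /\ ubound A m.

Definition geodesic_type (g : metric) (a : one_form) (T : R) (c : R -> M) :=
  [/\ embedded_loop T c, geodesic g c &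
      forall t v, ext_d a (c t) (velocity c t) v = 0].

Definition strong_geodesic_type (g : metric) (a : one_form) (T : R)
    (c : R -> M) :=
  [/\ geodesic_type g a T c, coorientable T c, null_homologous T c,
      forall t, is_max (range (conorm g a)) (conorm g a (c t)) &
      forall t v, g (c t) (velocity c t) v = a (c t) v].

Definition lagrangian (g : metric) (a : one_form) (z : tangent_bundle M) : R :=
  2^-1 * g z.1 z.2 z.2 - a z.1 z.2.

Definition action (g : metric) (a : one_form) (kappa T : R) (c : R -> M) : R :=
  \int[lebesgue_measure]_(t in `[0, T])
    (lagrangian g a (lift_curve c t) + kappa).

Definition mane_strict (g : metric) (a : one_form) : R :=
  inf [set kappa | forall T c, smooth_loop T c -> null_homologous T c ->
                     0 <= action g a kappa T c].

Definition mane_lowest (g : metric) (a : one_form) : R :=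
  inf [set kappa | forall T c, smooth_loop T c -> contractible T c ->
                     0 <= action g a kappa T c].

End Manifold.

(* Main.v *)
Require Import Defs.
From mathcomp Require Import all_boot all_order all_algebra.
From mathcomp Require Import all_classical all_reals all_analysis.
From mathcomp Require Import ring lra.
Import Order.TTheory GRing.Theory Num.Theory.
Import numFieldNormedType.Exports.
Local Open Scope classical_set_scope.
Local Open Scope ring_scope.

(* Let c be a loop of strong geodesic type and m = |alpha|_oo. Its velocity is
   dual to alpha, hence has constant length m > 0. Since c is a geodesic whose
   velocity lies in ker(d alpha), each reparametrisation t |-> c(k t) is a
   magnetic geodesic; k = sqrt(2 kappa) / m gives energy kappa and integrand
   2 kappa - m sqrt(2 kappa) of the action. The Lagrangian satisfies
   L + kappa >= |v - alpha^#|^2 / 2 for kappa >= m^2 / 2, whereas c itself has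
   action T (kappa - m^2 / 2); this computes both critical values. *)

(** * Directional derivatives under scaling of the direction or of the argument *)

Section DirectionalDerivative.
Context {R : realType} {V W : normedModType R}.
Implicit Types (f : V -> W) (k : R) (x v : V).

(** Substitute h k for h in the difference quotient; as k is nonzero, h k stays in the punctured
    neighbourhood of 0. Only one direction is assumed derivable, so linearity of a differential is
    not at hand. *)
Lemma is_derive_scale_dir f k x v : k != 0 -> derivable f x v ->
  is_derive x (k *: v) f (k *: 'D_v f x).
Proof.
move=> k0 fx.
have lin : (h * k @[h --> 0^'] --> (0 : R)^')%classic.
  have k_cvg : (h * k @[h --> (0 : R)] --> (0 : R))%classic.
    by rewrite -[X in _ --> X](mul0r k); exact: mulrr_continuous.
  move=> A A0; suff : nbhs (0 : R) [set h | h != 0 -> A (h * k)] by [].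
  apply: (@filterS _ (nbhs (0 : R)) _ _ _ _ (k_cvg _ A0)) => h /= Ah h0.
  by apply: Ah; rewrite mulf_neq0.
have E : (fun h : R => h^-1 *: ((f \o shift x) (h *: (k *: v)) - f x)) =
    (fun h => k *: ((h * k)^-1 *: ((f \o shift x) ((h * k) *: v) - f x))).
  by apply/funext => h; rewrite !scalerA invfM mulrCA mulfV// mulr1.
have cv : h^-1 *: ((f \o shift x) (h *: (k *: v)) - f x) @[h --> 0^'] -->
    k *: 'D_v f x.
  rewrite E; apply: cvgZl_tmp.
  exact: (@cvg_comp _ _ _ (fun h => h * k)
    (fun h : R => h^-1 *: ((f \o shift x) (h *: v) - f x)) _ _ _ lin fx).
apply: DeriveDef; first by apply/cvg_ex; exists (k *: 'D_v f x).
exact: cvg_lim cv.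
Qed.

Lemma derive_scale_dir f k x v : k != 0 -> derivable f x v ->
  'D_(k *: v) f x = k *: 'D_v f x.
Proof. by move=> k0 /(is_derive_scale_dir _ _ _ _ k0) ?; exact: derive_val. Qed.

(** The quotients agree before any limit is taken, so the chain rule for scaling holds as an
    identity of functions, for every k and without derivability. *)
Lemma comp_scale_quotient f k x v :
  (fun h : R => h^-1 *: (((f \o *:%R k) \o shift x) (h *: v) - (f \o *:%R k) x)) =
  (fun h : R => h^-1 *: ((f \o shift (k *: x)) (h *: (k *: v)) - f (k *: x))).
Proof.
apply/funext => h /=; congr (_ *: (f _ - _)).
by rewrite scalerDr !scalerA mulrC.
Qed.

Lemma derive_comp_scale f k v :
  'D_v (f \o *:%R k) = ('D_(k *: v) f) \o *:%R k.
Proof. by apply/funext => x; rewrite /derive comp_scale_quotient. Qed.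

Lemma derivable_comp_scale f k x v :
  derivable f (k *: x) (k *: v) -> derivable (f \o *:%R k) x v.
Proof. by rewrite /derivable comp_scale_quotient. Qed.

(** Induction on m: [Ck] quantifies over all directions, so the induction hypothesis applies to the
    derivative of f along k v. *)
Lemma Ck_comp_scale m (U : set V) f k : Ck m U f ->
  Ck m ( *:%R k @^-1` U) (f \o *:%R k).
Proof.
have cscale (h : V -> W) : (forall x, U x -> {for x, continuous h}) ->
    forall x, U (k *: x) -> {for x, continuous (h \o *:%R k)}.
  move=> ch x Ux; apply: continuous_comp; last exact: ch.
  exact: scaler_continuous.
elim: m f => [|m IH] f /= [cf df]; split=> //; [exact: cscale|exact: cscale|].
move=> v; have [dv cv] := df (k *: v); split.
  by move=> x Ux; apply: derivable_comp_scale; exact: dv.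
by rewrite derive_comp_scale; exact: IH.
Qed.

Lemma smooth_on_derivable (U : set V) f x v : smooth_on U f -> U x ->
  derivable f x v.
Proof. by move=> /(_ 1%N) [_ /(_ v) [+ _]]; exact. Qed.

Lemma smooth_on_derivable2 (U : set V) f x u v : smooth_on U f -> U x ->
  derivable ('D_u f) x v.
Proof. by move=> /(_ 2%N) [_ /(_ u) [_ [_ /(_ v) [+ _]]]]; exact. Qed.

End DirectionalDerivative.

(** * Linear algebra in one tangent space: duality, dual norm, lower bound for L *)

Section PointwiseForms.
Context {R : realType} {n : nat} {M : manifold R n} (g : metric M).
Context (a : one_form M).
Implicit Types (q : M) (u v w : 'rV[R]_n).

Lemma form0 q : a q 0 = 0.
Proof. by have := form_linear a q (-1) 0 0; rewrite scaler0 addr0 mulN1r addNr. Qed.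

Lemma formZ q k v : a q (k *: v) = k * a q v.
Proof. by rewrite -[_ *: _]addr0 form_linear form0 addr0. Qed.

Lemma gmet0l q v : g q 0 v = 0.
Proof.
by have := gmet_linear g q (-1) 0 0 v; rewrite scaler0 addr0 mulN1r addNr.
Qed.

Lemma gmetZl q k u v : g q (k *: u) v = k * g q u v.
Proof. by rewrite -[_ *: _]addr0 gmet_linear gmet0l addr0. Qed.

Lemma gmetZr q k u v : g q u (k *: v) = k * g q u v.
Proof. by rewrite gmet_sym gmetZl gmet_sym. Qed.

Lemma gmetDl q u v w : g q (u + v) w = g q u w + g q v w.
Proof. by rewrite -[u in LHS]scale1r gmet_linear mul1r. Qed.

Lemma gmetDr q u v w : g q w (u + v) = g q w u + g q w v.
Proof. by rewrite gmet_sym gmetDl !(gmet_sym g q w). Qed.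

Lemma gmet_ge0 q v : 0 <= g q v v.
Proof.
by have [->|/gmet_pos/ltW//] := eqVneq v 0; rewrite gmet0l.
Qed.

Lemma gmet_cauchy_schwarz q u v : g q u v ^+ 2 <= g q u u * g q v v.
Proof.
have [->|v0] := eqVneq v 0; first by rewrite (gmet_sym g) !gmet0l expr0n mulr0.
(* With A, B, C as set below, the squared length of C u - B v is C (A C - B^2), and C > 0 can be
   divided out. *)
have := gmet_ge0 q (g q v v *: u + (- g q u v) *: v).
rewrite !(gmetDl, gmetDr, gmetZl, gmetZr) (gmet_sym g q v u).
set A := g q u u; set B := g q u v; set C := g q v v => H.
have C0 : 0 < C by exact: gmet_pos.
rewrite -subr_ge0 -(pmulr_rge0 _ C0).
by apply: le_trans H _; rewrite le_eqVlt; apply/orP; left; apply/eqP; ring.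
Qed.

Lemma gmet_inj q w w' : (forall v, g q w v = g q w' v) -> w = w'.
Proof.
move=> ww; apply/eqP; rewrite -subr_eq0; apply: contraT => /(gmet_pos g q).
by rewrite gmetDl -scaleN1r gmetZl ww mulN1r subrr ltxx.
Qed.

Lemma sharp_eq q (l : 'rV[R]_n -> R) w : (forall v, g q w v = l v) ->
  sharp g q l = w.
Proof.
by move=> wl; apply: xget_unique => //= w' w'l; apply: (gmet_inj q) => v; rewrite w'l.
Qed.

(* If [l] has no representative, both sides are the default value 0 of [sharp]. *)
Lemma sharpZ q (l : 'rV[R]_n -> R) k : k != 0 ->
  sharp g q (fun v => k * l v) = k *: sharp g q l.
Proof.
move=> k0; have [[w wl]|nl] := pselect (exists w, forall v, g q w v = l v).
  rewrite (sharp_eq _ _ _ wl); apply: sharp_eq => v.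
  by rewrite gmetZl wl.
rewrite /sharp !xgetPN ?scaler0// => w wl; apply: nl.
  by exists w.
by exists (k^-1 *: w) => v; rewrite gmetZl wl mulKf.
Qed.

(** Cauchy-Schwarz bounds the dual norm by |w|, and the unit vector w / |w| attains the bound when w
    is nonzero. *)
Lemma conorm_sharp q w : (forall v, g q w v = a q v) ->
  conorm g a q = Num.sqrt (g q w w).
Proof.
move=> wa; rewrite /conorm; set A := [set _ | _ in _].
have A0 : A 0 by exists 0; rewrite /= ?gmet0l ?ler01// form0 normr0.
have ubA : ubound A (Num.sqrt (g q w w)).
  move=> _ [v /= v1 <-]; rewrite -wa -sqrtr_sqr ler_sqrt ?gmet_ge0//.
  apply: le_trans (gmet_cauchy_schwarz q w v) _.
  by rewrite ler_piMr ?gmet_ge0.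
apply/eqP; rewrite eq_le ge_sup//=; last by exists 0.
apply: ub_le_sup; first by exists (Num.sqrt (g q w w)).
have [->|w0] := eqVneq w 0; first by rewrite gmet0l sqrtr0.
have s0 : 0 < Num.sqrt (g q w w) by rewrite sqrtr_gt0 gmet_pos.
have sE := sqr_sqrtr (gmet_ge0 q w).
exists ((Num.sqrt (g q w w))^-1 *: w).
  by rewrite /= gmetZl gmetZr -{3}sE expr2 mulKf ?gt_eqF// mulVf ?gt_eqF.
by rewrite -wa gmetZr -{2}sE expr2 mulKf ?gt_eqF// gtr0_norm.
Qed.

Lemma conorm_ge0 q : 0 <= conorm g a q.
Proof. by rewrite (conorm_sharp q _ (@sharpP _ _ _ g q (a q) (form_linear a q))) sqrtr_ge0. Qed.

(** Complete the square: with w dual to alpha, L(q, v) + |w|^2 / 2 = |v - w|^2 / 2. *)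
Lemma lagrangian_ge q v :
  - (2^-1 * conorm g a q ^+ 2) <= lagrangian g a (q, v).
Proof.
have wa := @sharpP _ _ _ g q (a q) (form_linear a q).
set w := sharp g q (a q) in wa.
rewrite (conorm_sharp _ _ wa) sqr_sqrtr ?gmet_ge0// /lagrangian /=.
have := gmet_ge0 q (v + (-1) *: w).
by rewrite !(gmetDl, gmetDr, gmetZl, gmetZr) (gmet_sym g q v w) (wa v); lra.
Qed.

End PointwiseForms.

(** * Homogeneity of the Christoffel term and of d alpha *)

Section ScalingInCharts.
Context {R : realType} {n : nat} {M : manifold R n} (g : metric M).
Context (a : one_form M) (k : R) (k0 : k != 0).
Implicit Types (i : chart_index M) (q : M) (u v w x : 'rV[R]_n).

Lemma tvecZ i q v : dom (atlas i) q -> tvec i q (k *: v) = k *: tvec i q v.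
Proof.
move=> qi; apply: derive_scale_dir => //.
apply: (smooth_on_derivable _ _ _ _ (atlas_smooth i (chart_at q))).
by exists q => //; split => //; exact: mem_chart_at.
Qed.

Lemma codom_chart_param i x : codom_chart i x -> dom (atlas i) (param (atlas i) x).
Proof. by case=> q qi <-; rewrite coordK. Qed.

Lemma near_codom_chart q :
  \forall x \near Defs.coord (atlas (chart_at q)) q, codom_chart (chart_at q) x.
Proof.
apply: open_nbhs_nbhs; split; first exact: open_coord.
by exists q => //; exact: mem_chart_at.
Qed.

Lemma codom_chart_at q : codom_chart (chart_at q) (Defs.coord (atlas (chart_at q)) q).
Proof. exact: nbhs_singleton (near_codom_chart q). Qed.

Lemma bilin_inZl i u v x : codom_chart i x ->
  bilin_in g i (k *: u) v x = k * bilin_in g i u v x.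
Proof. by move=> /codom_chart_param xi; rewrite /bilin_in tvecZ// gmetZl. Qed.

Lemma bilin_inZr i u v x : codom_chart i x ->
  bilin_in g i u (k *: v) x = k * bilin_in g i u v x.
Proof. by move=> /codom_chart_param xi; rewrite /bilin_in tvecZ// gmetZr. Qed.

Lemma lin_inZ i v x : codom_chart i x ->
  lin_in a i (k *: v) x = k * lin_in a i v x.
Proof. by move=> /codom_chart_param xi; rewrite /lin_in tvecZ// formZ. Qed.

(** Homogeneity of chart components is established only on the open set [codom_chart i]; this local
    form carries it through a derivative. *)
Lemma derive_near_scale {V : normedModType R} (f h : V -> R) (x v : V) (r : R) :
  (\forall y \near x, h y = r * f y) -> derivable f x v ->
  'D_v h x = r * 'D_v f x.
Proof.
move=> hf fx; rewrite (near_eq_derive v hf).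
by rewrite (_ : (fun y => r * f y) = r \*: f) ?deriveZ.
Qed.

Lemma derivable_bilin_in q u v w :
  derivable (bilin_in g (chart_at q) u v) (Defs.coord (atlas (chart_at q)) q) w.
Proof.
exact: (smooth_on_derivable _ _ _ _ (gmet_smooth g _ u v) (codom_chart_at q)).
Qed.

Lemma derivable_lin_in q v w :
  derivable (lin_in a (chart_at q) v) (Defs.coord (atlas (chart_at q)) q) w.
Proof.
exact: (smooth_on_derivable _ _ _ _ (form_smooth a _ v) (codom_chart_at q)).
Qed.

Lemma christoffelZ q u :
  christoffel g q (k *: u) (k *: u) = k ^+ 2 *: christoffel g q u u.
Proof.
rewrite /christoffel -sharpZ ?expf_neq0//; congr sharp; apply/funext => v.
set i := chart_at q; set x := Defs.coord _ q.
have E1 : 'D_(k *: u) (bilin_in g i (k *: u) v) x =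
    k ^+ 2 * 'D_u (bilin_in g i u v) x.
  rewrite (derive_near_scale (bilin_in g i u v) _ _ _ k).
  - rewrite derive_scale_dir//; [exact: mulrA|exact: derivable_bilin_in].
  - by apply: filterS (near_codom_chart q) => y yi; rewrite bilin_inZl.
  - exact: derivable_bilin_in.
have E2 : 'D_v (bilin_in g i (k *: u) (k *: u)) x =
    k ^+ 2 * 'D_v (bilin_in g i u u) x.
  apply: derive_near_scale; last exact: derivable_bilin_in.
  apply: filterS (near_codom_chart q) => y yi.
  rewrite (bilin_inZl _ _ _ _ yi) (bilin_inZr _ _ _ _ yi).
  exact: mulrA.
(* On the diagonal the first two Koszul terms coincide, so [E1] covers both; there one factor k
   comes from the direction and one from a slot, in [E2] both come from slots. *)
apply: etrans (congr2 (fun A B => 2^-1 * (A + A - B)) E1 E2) _.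
have dist (A B : R) : 2^-1 * (k ^+ 2 * A + k ^+ 2 * A - k ^+ 2 * B) =
    k ^+ 2 * (2^-1 * (A + A - B)) by ring.
exact: dist.
Qed.

Lemma ext_dZl q u v : ext_d a q (k *: u) v = k * ext_d a q u v.
Proof.
rewrite /ext_d derive_scale_dir//; last exact: derivable_lin_in.
rewrite (derive_near_scale (lin_in a (chart_at q) u) (lin_in _ _ (k *: u)) _ _ k).
- by rewrite mulrBr.
- by apply: filterS (near_codom_chart q) => y yi; rewrite lin_inZ.
- exact: derivable_lin_in.
Qed.

End ScalingInCharts.

(** * The loop t |-> c(k t), of period T / k *)

Section Reparametrisation.
Context {R : realType} {n : nat} {M : manifold R n} (g : metric M).
Context (a : one_form M) (k : R) (k0 : k != 0).
Implicit Types (c : R -> M) (t T : R).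

Lemma continuous_mulrl : continuous ( *%R k).
Proof. by move=> t; exact: mulrl_continuous. Qed.

Lemma smooth_curve_reparam c : smooth_curve c -> smooth_curve (c \o *%R k).
Proof.
case=> cc sc; split.
  by move=> t; apply: continuous_comp; [exact: continuous_mulrl|exact: cc].
by move=> i m; apply: (Ck_comp_scale _ _ _ k (sc i m)).
Qed.

Lemma derive1_comp_scale (f : R -> 'rV[R]_n) t : derivable f (k * t) 1 ->
  derive1 (f \o *%R k) t = k *: derive1 f (k * t).
Proof.
move=> ft; rewrite !derive1E [LHS](congr1 (fun h => h t) (derive_comp_scale f k 1)).
exact: derive_scale_dir.
Qed.

Lemma smooth_curve_near_dom c i t : smooth_curve c -> dom (atlas i) (c t) ->
  \forall s \near t, dom (atlas i) (c s).
Proof.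
by case=> cc _ ti; apply: cc; apply: open_nbhs_nbhs; split => //; exact: open_dom.
Qed.

Lemma derivable_coord c i t : smooth_curve c -> dom (atlas i) (c t) ->
  derivable (Defs.coord (atlas i) \o c) t 1.
Proof. by case=> _ /(_ i) sc ti; apply: (smooth_on_derivable _ _ _ _ sc). Qed.

Lemma velocity_reparam c t : smooth_curve c ->
  velocity (c \o *%R k) t = k *: velocity c (k * t).
Proof.
move=> sc; apply: derive1_comp_scale.
by apply: derivable_coord => //; exact: mem_chart_at.
Qed.

Lemma cov_accel_reparam c t : smooth_curve c ->
  cov_accel g (c \o *%R k) t = k ^+ 2 *: cov_accel g c (k * t).
Proof.
move=> sc; rewrite /cov_accel velocity_reparam// christoffelZ// scalerDr.
congr (_ + _); rewrite [(c \o _) t]/=.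
set i := chart_at (c (k * t)); have it : dom (atlas i) (c (k * t)).
  exact: mem_chart_at.
set f := Defs.coord (atlas i) \o c.
have D2 : derivable (derive1 f) (k * t) 1.
  rewrite (_ : derive1 f = 'D_1 f); last by apply/funext => s; rewrite derive1E.
  by apply: (smooth_on_derivable2 _ _ _ _ _ (sc.2 i)).
rewrite /derive1n /= [LHS]derive1E.
(* The chart is fixed at c(k t), so the first-derivative formula is available only for s near t;
   this suffices to differentiate once more. *)
have E : \forall s \near t,
    derive1 (Defs.coord (atlas i) \o (c \o *%R k)) s =
    (k \*: (derive1 f \o *%R k)) s.
  have near_dom := continuous_mulrl t _ (smooth_curve_near_dom _ _ _ sc it).
  apply: (@filterS _ (nbhs t) _ _ _ _ near_dom) => s si.
  by apply: (derive1_comp_scale f); exact: derivable_coord.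
rewrite (near_eq_derive _ E) deriveZ; last first.
  by apply: (derivable_comp_scale (derive1 f)); case: (is_derive_scale_dir _ _ _ _ k0 D2).
by rewrite -derive1E derive1_comp_scale// scalerA.
Qed.

(** Equal points select the same chart, so both velocities are limits of one and the same
    quotient. *)
Lemma velocity_periodic c T t : (forall s, c (s + T) = c s) ->
  velocity c (t + T) = velocity c t.
Proof.
move=> cT; rewrite /velocity /derive1 cT; set f := _ \o c.
suff -> : (fun h : R => h^-1 *: (f (h + (t + T)) - f (t + T))) =
          (fun h : R => h^-1 *: (f (h + t) - f t)) by [].
by apply/funext => h; rewrite /f /= addrA !cT.
Qed.

Lemma smooth_loop_reparam c T : 0 < k -> smooth_loop T c ->
  smooth_loop (T / k) (c \o *%R k).
Proof.
move=> kp [T0 sc cT]; split; first exact: divr_gt0.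
  exact: smooth_curve_reparam.
by move=> t /=; rewrite mulrDr mulrCA divff// mulr1 cT.
Qed.

Lemma embedded_loop_reparam c T : 0 < k -> embedded_loop T c ->
  embedded_loop (T / k) (c \o *%R k).
Proof.
move=> kp [lc vc ic oc]; have [T0 sc cT] := lc; split.
- exact: smooth_loop_reparam.
- by move=> t; rewrite velocity_reparam// scaler_eq0 negb_or k0 vc.
- move=> s t /= /ic [z zE]; exists z.
  by rewrite mulrA -zE -mulrBr mulrC mulKf.
(* The preimage of U under t |-> t / k is open and T-periodic, so the embedding property of c
   applies to it. *)
move=> U oU pU; have [||O oO UO] := oc ( *%R k^-1 @^-1` U).
- by apply: open_comp => // t _; exact: mulrl_continuous.
- by move=> t /=; rewrite mulrDr [_ * T]mulrC; exact: pU.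
exists O => //; rewrite comp_preimage -UO; apply/seteqP; split => t /=.
  by rewrite mulKf.
by rewrite mulKf.
Qed.

(** Since k (x T / k) = x T, both loops define the same singular 1-simplex, and the same 2-chain
    bounds it. *)
Lemma null_homologous_reparam c T : null_homologous T c ->
  null_homologous (T / k) (c \o *%R k).
Proof.
move=> [N [m [s [cs bs]]]]; exists N, m, s; split => // f; rewrite bs.
congr ((same_simplex _ _)%:R); apply/funext => x; rewrite /loop_simplex /=.
by congr c; rewrite mulrCA [k * _]mulrC divfK.
Qed.

(** Both sides of the equation vanish, whatever the speed: the acceleration because c is a geodesic,
    the Lorentz force because its velocity lies in the kernel of d alpha. *)
Lemma magnetic_geodesic_reparam c T : geodesic_type g a T c ->
  magnetic_geodesic g a (c \o *%R k).
Proof.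
move=> [_ [sc gc] dc]; split; first exact: smooth_curve_reparam.
move=> t; rewrite cov_accel_reparam// gc scaler0 /lorentz_force.
apply/esym/sharp_eq => v; rewrite gmet0l velocity_reparam// ext_dZl//=.
by rewrite dc mulr0.
Qed.

End Reparametrisation.

(** * The action along strong loops and the critical values *)

Section Action.
Context {R : realType} {n : nat} {M : manifold R n} (g : metric M).
Context (a : one_form M).
Implicit Types (c : R -> M) (T kappa : R).

Lemma action_const_lagrangian kappa T c (l : R) : 0 <= T ->
  (forall t, lagrangian g a (lift_curve c t) = l) ->
  action g a kappa T c = (l + kappa) * T.
Proof.
move=> T0 cl; rewrite /action.
under eq_Rintegral do rewrite cl.
have TE : lebesgue_measure `[0, T]%classic = T%:E :> \bar R.
  rewrite lebesgue_measure_itv/= lte_fin oppr0 addr0.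
  by case: ltP => // T0'; congr EFin; apply/le_anti/andP.
by rewrite Rintegral_cst//= TE.
Qed.

Section Strong.
Context (T : R) (c : R -> M) (Hc : strong_geodesic_type g a T c).

Let m := sup_conorm g a.

(** The maximum in the strong type condition also supplies the boundedness that makes [sup]
    meaningful. *)
Lemma strong_conorm t : conorm g a (c t) = m.
Proof.
case: Hc => _ _ _ /(_ t) [ct ub] _; apply/eqP; rewrite eq_le; apply/andP; split.
  by apply: ub_le_sup => //; exists (conorm g a (c t)).
by apply: ge_sup => //; exists (conorm g a (c t)).
Qed.

Lemma strong_conorm_le q : conorm g a q <= m.
Proof.
by case: Hc => _ _ _ /(_ 0) [_ ub] _; rewrite -(strong_conorm 0); apply: ub; exists q.
Qed.

Lemma strong_speed t : g (c t) (velocity c t) (velocity c t) = m ^+ 2.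
Proof.
case: Hc => _ _ _ _ /(_ t) va.
by rewrite -(strong_conorm t) (conorm_sharp _ _ _ _ va) sqr_sqrtr ?gmet_ge0.
Qed.

(** Were m zero, the velocity would have length zero, but c is an immersion. *)
Lemma strong_sup_conorm_gt0 : 0 < m.
Proof.
have m0 : 0 <= m by rewrite -(strong_conorm 0) conorm_ge0.
case: Hc => -[[_ /(_ 0) v0 _ _] _ _] _ _ _ _.
have := gmet_pos g (c 0) v0; rewrite strong_speed lt_def sqrf_eq0.
by case/andP => mn0 _; rewrite lt_def mn0.
Qed.

Lemma lagrangian_reparam k t : k != 0 ->
  lagrangian g a (lift_curve (c \o *%R k) t) = 2^-1 * (k * m) ^+ 2 - k * m ^+ 2.
Proof.
move=> k0; case: (Hc) => -[[[_ sc _] _ _ _] _ _] _ _ _ va.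
rewrite /lagrangian /= velocity_reparam// gmetZl gmetZr formZ -va strong_speed.
by ring.
Qed.

(* [P] is the class of test loops: null-homologous for the strict critical
   value, contractible for the lowest one. *)
Lemma inf_action_ge0 (P : R -> (R -> M) -> Prop) : P T c ->
  inf [set kappa | forall T' c', smooth_loop T' c' -> P T' c' ->
                     0 <= action g a kappa T' c'] = 2^-1 * m ^+ 2.
Proof.
move=> Pc; have [[[[T0 sc cT] _ _ _] _ _] _ _ _ _] := Hc.
set A := [set _ | _].
have Am : A (2^-1 * m ^+ 2).
  (* The integrand is nonnegative pointwise for every curve, whatever the class [P]. *)
  move=> T' c' _ _; apply: Rintegral_ge0 => t _.
  rewrite -lerBlDr sub0r; apply: le_trans (lagrangian_ge _ _ _ _).
  rewrite lerN2 ler_pM2l ?invr_gt0// ler_pXn2r ?nnegrE ?conorm_ge0//.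
    exact: strong_conorm_le.
  exact: ltW strong_sup_conorm_gt0.
have lbA : lbound A (2^-1 * m ^+ 2).
  move=> kappa /(_ T c); rewrite (action_const_lagrangian _ _ _ (- (2^-1 * m ^+ 2))).
  - by rewrite pmulr_lge0// addrC subr_ge0; exact.
  - exact: ltW.
  (* Speed factor 1 gives the Lagrangian along c itself, m^2 / 2 - m^2. *)
  move=> t; have := lagrangian_reparam 1 t (oner_neq0 _).
  rewrite (_ : c \o *%R 1 = c); last by apply/funext => s; rewrite /= mul1r.
  by move=> ->; lra.
apply/eqP; rewrite eq_le; apply/andP; split.
  by apply: ge_inf; first by exists (2^-1 * m ^+ 2).
by apply: lb_le_inf; first by exists (2^-1 * m ^+ 2).
Qed.

End Strong.
End Action.


Theorem theorem2 (R : realType) (n : nat) (M : manifold R n)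
    (HM : closed_connected M) (g : metric M) (alpha : one_form M)
    (Hstrong : exists T c, strong_geodesic_type g alpha T c) :
  [/\ forall kappa : R, 0 < kappa ->
        exists (T : R) (z : R -> tangent_bundle M),
          let c := fun t => (z t).1 in
          [/\ periodic_flow_orbit g alpha T z,
              embedded_loop T c,
              null_homologous T c,
              forall t, energy g (z t) = kappa &
              kappa <= mane_strict g alpha -> action g alpha kappa T c <= 0],
      mane_strict g alpha = 2^-1 * sup_conorm g alpha ^+ 2 &
      (exists T c, strong_geodesic_type g alpha T c /\ contractible T c) ->
        mane_lowest g alpha = mane_strict g alpha /\
        mane_strict g alpha = 2^-1 * sup_conorm g alpha ^+ 2].
Proof.
have [T [c Hc]] := Hstrong.
have [gt _ nh _ _] := Hc; have [emb _ _] := gt; have [[T0 sc cT] _ _ _] := emb.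
set m := sup_conorm g alpha.
have m0 : 0 < m := strong_sup_conorm_gt0 _ _ _ _ Hc.
have c0E : mane_strict g alpha = 2^-1 * m ^+ 2.
  exact: (inf_action_ge0 _ _ _ _ Hc (@null_homologous R n M)).
split=> [kappa kappa0||[T' [c' [Hc' ctr]]]]; last 2 first.
- exact: c0E.
(* The contractible loop c' may differ from c, but the value obtained depends only on m. *)
- split=> //; rewrite c0E.
  exact: (inf_action_ge0 _ _ _ _ Hc' (@contractible R n M)).
(* r is the speed of energy kappa; c has speed m, hence the factor r / m. *)
pose r := Num.sqrt (2 * kappa); pose k := r / m.
have r0 : 0 < r by rewrite sqrtr_gt0 mulr_gt0.
have k_gt0 : 0 < k by exact: divr_gt0.
have kn0 : k != 0 by rewrite gt_eqF.
have km : k * m = r by rewrite /k divfK ?gt_eqF.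
have rE : r ^+ 2 = 2 * kappa by rewrite sqr_sqrtr// mulr_ge0// ltW.
have emb' := embedded_loop_reparam k kn0 c T k_gt0 emb.
have [[T'0 _ cT'] _ _ _] := emb'.
exists (T / k), (lift_curve (c \o *%R k)); split => //.
- split=> //; first by exists (c \o *%R k) => //; exact: magnetic_geodesic_reparam gt.
  by move=> t; rewrite /lift_curve (velocity_periodic _ _ _ cT') cT'.
- exact: null_homologous_reparam.
- move=> t; rewrite /energy /= velocity_reparam// gmetZl gmetZr.
  by rewrite (strong_speed _ _ _ _ Hc) -/m mulrA -expr2 -exprMn km rE mulrA mulVf ?mul1r.
rewrite c0E => kle.
rewrite (action_const_lagrangian _ _ _ _ _ (2^-1 * (k * m) ^+ 2 - k * m ^+ 2)); last 2 first.
- exact: ltW.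
- by move=> t; exact: (lagrangian_reparam _ _ _ _ Hc).
have -> : k * m ^+ 2 = r * m by rewrite expr2 mulrA km.
(* The integrand is r^2 / 2 - r m + kappa = r (r - m), and kappa <= m^2 / 2 says r <= m after
   squaring. *)
have rm : r <= m by rewrite -(@ler_pXn2r _ 2) ?nnegrE ?(ltW r0) ?(ltW m0)// rE; lra.
have : r ^+ 2 <= r * m by rewrite expr2 ler_pM2l.
by rewrite pmulr_lle0// km rE; lra.
Qed.
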